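(* Let $T$ be a tree on $n$ vertices. Then $T$ is NEB at some vertex $v$ if and only if $\operatorname{match}(T)=\lfloor n/2\rfloor$.
   Context: $\operatorname{match}(G)$ denotes the matching number of a graph $G$, i.e. the maximum number of edges in a matching (a set of pairwise vertex-disjoint edges). For a tree $T$ and a vertex $v$, $T(v)$ denotes the forest obtained from $T$ by deleting $v$, and for a neighbor $w$ of $v$, $T_w(v)$ denotes the connected component of $T(v)$ containing $w$. A component is odd if it has an odd number of vertices. NEB is defined recursively: let $T$ be a tree on $n$ vertices and $w$ a vertex of $T$. If $n=1$, $T$ is NEB at $w$. If $n\ge 2$, $T$ is NEB at $w$ if (i) $T(w)$ has exactly one odd component when $n$ is even, and $T(w)$ has no odd component when $n$ is odd; and (ii) for each neighbor $v$ of $w$ in $T$, the tree $T_v(w)$ is NEB at $v$. *)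

(* Defs.v *)
From mathcomp Require Import all_boot.
Set Implicit Arguments.
Unset Strict Implicit.
Unset Printing Implicit Defensive.

(* A finite graph is given by its adjacency relation e on a finType V;        *)
(* subgraphs are the induced ones, identified with their vertex set A.        *)

Record simple_graph (V : finType) (e : rel V) : Prop := SimpleGraph {
  adj_sym : symmetric e;
  adj_irr : irreflexive e
}.

(* The size condition excludes the degenerate 2-cycle x, y, x carried by      *)
(* every edge of a symmetric relation.                                        *)
Definition acyclic (V : finType) (e : rel V) : Prop :=
  forall c : seq V, 2 < size c -> ~ ucycle e c.

Record tree (V : finType) (e : rel V) : Prop := Tree {
  tree_simple : simple_graph e;
  tree_nonempty : 0 < #|V|;
  tree_connected : forall x y : V, connect e x y;
  tree_acyclic : acyclic e
}.

Section Graph.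
Variables (V : finType) (e : rel V).
Implicit Types (A : {set V}) (M : {set {set V}}) (v w x y : V).

Definition edges : {set {set V}} := [set [set x; y] | x in V, y in V & e x y].

Definition matching M : bool := (M \subset edges) && trivIset M.

Definition match_number : nat := \max_(M : {set {set V}} | matching M) #|M|.

Definition induced A : rel V := [rel x y | [&& x \in A, y \in A & e x y]].

Definition component A x : {set V} := [set y in A | connect (induced A) x y].

Definition components A : {set {set V}} := [set component A x | x in A].

Definition odd_components A : {set {set V}} :=
  [set C in components A | odd #|C|].

(* NEB A w: the subgraph induced on A is NEB at w. With T the subgraph        *)
(* induced on A, the forest T(w) is induced on A :\ w and T_v(w) is induced   *)
(* on component (A :\ w) v.                                                   *)
Inductive NEB : {set V} -> V -> Prop :=
| NEB_single A w : w \in A -> #|A| = 1 -> NEB A w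
| NEB_step A w :
    w \in A -> 2 <= #|A| ->
    (~~ odd #|A| -> #|odd_components (A :\ w)| = 1) ->
    (odd #|A| -> #|odd_components (A :\ w)| = 0) ->
    (forall v, v \in A -> e w v -> NEB (component (A :\ w) v) v) ->
    NEB A w.

End Graph.

(* Main.v *)
Require Import Defs.
From mathcomp Require Import all_boot.

Set Implicit Arguments.
Unset Strict Implicit.
Unset Printing Implicit Defensive.

(** A tree [A] is NEB at [w] exactly when [A] (if [#|A|] is even) or [A :\ w]
    (if [#|A|] is odd) has a perfect matching.  From left to right, the
    components of [A :\ w] are matched recursively; when [#|A|] is even, the
    unique odd component is matched up to its vertex next to [w], which is then
    matched with [w].  From right to left, a perfect matching restricts to each
    component of [A :\ w], up to the partner of [w]; acyclicity makes this
    partner the only neighbour of [w] in its component.  A matching of size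
    [n %/ 2] misses at most one vertex, and the tree is NEB there. *)

(** * Perfect matchings as involutions, and the matching number *)

Section Pairing.
Variables (V : finType) (e : rel V).
Hypothesis eG : simple_graph e.
Implicit Types (A B C : {set V}) (M : {set {set V}}) (f : V -> V).

Let e_sym : symmetric e := adj_sym eG.
Let e_irr : irreflexive e := adj_irr eG.

(** Encodes a perfect matching of the graph induced on [B] by the map sending each vertex to its
    partner. In this form it restricts to stable subsets and glues over components; values outside
    [B] are free. *)
Definition pairing B f : Prop :=
  forall x, x \in B -> [/\ f x \in B, f (f x) = x & e x (f x)].

Definition paired B : Prop := exists f, pairing B f.

Lemma edgesP (E : {set V}) :
  reflect (exists x y, e x y /\ E = [set x; y]) (E \in edges e).
Proof.
apply: (iffP imset2P) => [[x y _]|[x [y [exy ->]]]].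
  by rewrite inE => /andP[_ exy] ->; exists x, y.
by exists x y => //; rewrite inE exy.
Qed.

Lemma card_cover_matching M : matching e M -> #|cover M| = #|M|.*2.
Proof.
case/andP=> /subsetP sM /eqP <-; rewrite -muln2 -sum_nat_const.
apply: eq_bigr => E /sM /edgesP[x [y [exy ->]]].
by rewrite cards2; case: eqVneq exy => // ->; rewrite e_irr.
Qed.

Lemma matching_paired M : matching e M -> paired (cover M).
Proof.
case/andP=> /subsetP sM tM.
(* The default [x] is never reached on [cover M], and disjointness of the edges of [M] makes the
   picked partner unique. *)
exists (fun x => odflt x [pick y | e x y && ([set x; y] \in M)]).
have pickE x y : e x y -> [set x; y] \in M ->
    odflt x [pick z | e x z && ([set x; z] \in M)] = y.
  move=> exy xyM; case: pickP => [z /= /andP[exz xzM]|/(_ y)]; last by rewrite exy xyM.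
  have/eqP eqE : [set x; y] == [set x; z].
    apply/negPn/negP => neq; have := trivIsetP tM _ _ xyM xzM neq.
    by move=> /disjoint_setI0/setP/(_ x); rewrite !inE eqxx.
  have: z \in [set x; y] by rewrite eqE !inE eqxx orbT.
  by rewrite !inE => /orP[/eqP zx|/eqP //]; rewrite zx e_irr in exz.
move=> x /bigcupP[E EM xE].
have [y [exy xyM]] : exists y, e x y /\ [set x; y] \in M.
  case/edgesP: (sM _ EM) => a [b [eab dE]]; move: xE; rewrite dE !inE.
  case/orP=> /eqP ->; first by exists b; rewrite -dE.
  by exists a; rewrite e_sym setUC -dE.
have yxM : [set y; x] \in M by rewrite setUC.
have eyx : e y x by rewrite e_sym.
rewrite (pickE x y) // (pickE y x) //; split=> //.
by apply/bigcupP; exists [set x; y] => //; rewrite !inE eqxx orbT.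
Qed.

Lemma paired_matching B : paired B -> exists2 M, matching e M & cover M = B.
Proof.
case=> f pf; exists [set [set x; f x] | x in B]; last first.
  apply/setP=> x; apply/bigcupP/idP => [[_ /imsetP[y yB ->]]|xB].
    by rewrite !inE => /orP[] /eqP -> //; case: (pf y yB).
  by exists [set x; f x]; [apply: imset_f | rewrite !inE eqxx].
apply/andP; split.
  apply/subsetP => _ /imsetP[x xB ->]; apply/edgesP.
  by exists x, (f x); split=> //; case: (pf x xB).
apply/trivIsetP => _ _ /imsetP[x xB ->] /imsetP[y yB ->]; apply: contraR.
(* Blocks are orbits of the involution [f], so two blocks sharing [z] both equal the block of
   [z]. *)
have blockE a z : a \in B -> z \in [set a; f a] -> [set a; f a] = [set z; f z].
  move=> aB; have [_ ffa _] := pf a aB.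
  by rewrite !inE => /orP[] /eqP -> //; rewrite ffa setUC.
rewrite -setI_eq0 => /set0Pn[z /setIP[zx zy]].
by rewrite (blockE x z) // (blockE y z).
Qed.

Lemma odd_paired B : paired B -> odd #|B| = false.
Proof. by case/paired_matching=> M mM <-; rewrite card_cover_matching ?odd_double. Qed.

Lemma match_number_le : match_number e <= #|V|./2.
Proof.
apply/bigmax_leqP => M mM; rewrite -(doubleK #|M|) half_leq //.
by rewrite -card_cover_matching // max_card.
Qed.

Lemma match_number_attained :
  exists2 M, matching e M & match_number e = #|M|.
Proof.
have m0 : matching e set0.
  by rewrite /matching sub0set; apply/trivIsetP => A B; rewrite inE.
by exists [arg max_(M > set0 | matching e M) #|M|];
  [case: arg_maxnP | rewrite /match_number (bigmax_eq_arg set0)].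
Qed.

Lemma match_number_half : 0 < #|V| ->
  match_number e = #|V| %/ 2 <->
  exists w, paired (if odd #|V| then [set: V] :\ w else [set: V]).
Proof.
rewrite divn2 => V0; split=> [maxE | [w /paired_matching[M mM cM]]].
  have [M mM sM] := match_number_attained.
  (* A matching of size [#|V|./2] leaves out exactly [odd #|V|] vertices: one vertex, which serves
     as [w], or none, and then any [w] will do. *)
  have cardM : #|cover M| + odd #|V| = #|V|.
    by rewrite card_cover_matching // -sM maxE addnC odd_double_half.
  have pM := matching_paired mM; have cardC := cardsC (cover M).
  move: cardM cardC; case: (odd _) => /= cardM; rewrite -[in RHS]cardM.
    case/addnI/eqP/cards1P=> w dC; exists w.
    by rewrite setTD -dC setCK.
  case/addnI/cards0_eq=> dC; have [w _] := card_gt0P V0; exists w.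
  by rewrite -setC0 -dC setCK.
apply/eqP; rewrite eqn_leq match_number_le /=.
suff <- : #|M| = #|V|./2 by apply: leq_bigmax_cond.
rewrite -(doubleK #|M|) -card_cover_matching // cM.
case: ifP => oV; last by rewrite cardsT.
rewrite setTD cardsC1; case: #|V| oV => //= k /negPf ok.
by rewrite uphalf_half ok.
Qed.
End Pairing.

(** * Components of a tree minus a vertex, and the two directions of the equivalence *)

Section Components.
Variables (V : finType) (e : rel V).
Hypothesis eG : simple_graph e.
Implicit Types (A B C : {set V}) (f : V -> V).

Let e_sym : symmetric e := adj_sym eG.
Let e_irr : irreflexive e := adj_irr eG.

Definition connected_in A : Prop :=
  {in A &, forall x y, connect (induced e A) x y}.

Lemma induced_csym A : connect_sym (induced e A).
Proof. by apply: sym_connect_sym => x y; rewrite /induced /= e_sym andbCA. Qed.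

Lemma mem_component A x : x \in A -> x \in component e A x.
Proof. by move=> xA; rewrite inE xA connect0. Qed.

Lemma component_sub A x : component e A x \subset A.
Proof. by apply/subsetP => y; rewrite inE => /andP[]. Qed.

Lemma component_eq A x y : y \in component e A x -> component e A y = component e A x.
Proof.
rewrite inE => /andP[_ cxy]; apply/setP => z.
by rewrite !inE (same_connect (@induced_csym A) cxy).
Qed.

Lemma component_adj A x y z :
  y \in component e A x -> z \in A -> e y z -> z \in component e A x.
Proof.
rewrite !inE => /andP[yA cxy] zA eyz; rewrite zA.
by apply: connect_trans cxy (connect1 _); rewrite /induced /= yA zA.
Qed.

Lemma connected_component A v : connected_in (component e A v).
Proof.
move=> x y xC yC.
have: connect (induced e A) x y.
  by move: yC; rewrite -(component_eq xC) inE => /andP[].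
case/connectP=> p pth ->; elim: p x {yC} xC pth => [|z p IHp] x xC /=.
  by rewrite connect0.
case/andP=> /and3P[_ zA exz] pth; have zC := component_adj xC zA exz.
by apply: connect_trans (IHp z zC pth); apply: connect1; rewrite /induced /= xC zC.
Qed.

(** On a duplicate-free path from [w] to [x], the second vertex is the required neighbour: the rest
    of the path avoids [w], so it stays in one component. *)
Lemma component_neighbor A w x :
    connected_in A -> w \in A -> x \in A :\ w ->
  exists v, [/\ v \in A, e w v & component e (A :\ w) v = component e (A :\ w) x].
Proof.
move=> cA wA /setD1P[xw xA].
case/connectP: (cA w x wA xA) => p pth dx.
move: xw; rewrite dx; case/shortenP: pth => q.
case: q => [|v q] /=; first by rewrite eqxx.
case/andP=> /and3P[_ vA ewv] pth /andP[]; rewrite inE => /norP[wv wq] _ _ _.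
exists v; split=> //; apply/esym/component_eq.
have {wA} : v \in A :\ w by rewrite !inE eq_sym wv.
elim: q v {vA ewv wv} pth wq => [|z q IHq] v /=; first by move=> *; exact: mem_component.
case/andP=> /and3P[_ zA evz] pth; rewrite inE => /norP[wz wq] vA.
have zA' : z \in A :\ w by rewrite !inE eq_sym wz.
by rewrite -(component_eq (component_adj (mem_component vA) zA' evz)) IHq.
Qed.

(** Otherwise a simple path from [v] to [u] avoiding [w] would close up through [w] into a cycle. *)
Lemma acyclic_component A w u v :
    acyclic e -> e w u -> e w v -> v \in A :\ w ->
  u \in component e (A :\ w) v -> u = v.
Proof.
move=> acyc ewu ewv vA; rewrite inE => /andP[_ /connectP[p pth du]].
apply/eqP/negPn/negP => uv; move: uv ewu; rewrite {u}du.
case/shortenP: pth => q pth uq _ uv ewu.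
have pe : path e v q by apply: sub_path pth => x y /= /and3P[].
have wq : w \notin v :: q.
  have: all (mem (A :\ w)) (v :: q).
    rewrite /= vA; elim: q v pth {vA uq uv ewu ewv pe} => //= z q IHq v.
    by case/andP=> /and3P[_ -> _] /IHq.
  by apply: contraL => wvq; apply/allPn; exists w; rewrite //= !inE eqxx.
(* As [u] differs from [v], [q] is nonempty and the cycle has at least three vertices. *)
case: (acyc (w :: v :: q)); first by case: q uv {uq pth ewu pe wq}; rewrite //= eqxx.
by rewrite /ucycle /= rcons_path ewv pe e_sym ewu wq.
Qed.

(** Each local pairing maps its component minus [u] to itself, so the pairings glue. Deleting [u]
    from every component is harmless, as at most one contains it. *)
Lemma paired_components B u :
  (forall x, x \in B -> paired e (component e B x :\ u)) -> paired e (B :\ u).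
Proof.
move=> H.
(* Choosing one pairing per component, rather than per vertex, keeps the choice the same at [x] and
   at its partner. *)
have [F pF] : exists F : {set V} -> V -> V,
    forall C, C \in components e B -> pairing e (C :\ u) (F C).
  apply: (@fin_all_exists _ (fun=> V -> V)
    (fun C g => C \in components e B -> pairing e (C :\ u) g)) => C.
  have [/imsetP[x xB ->]|_] := boolP (C \in components e B); last by exists id.
  by have [f pf] := H x xB; exists f.
exists (fun x => F (component e B x) x) => x /setD1P[xu xB].
have [] := pF _ (imset_f (component e B) xB) x; first by rewrite !inE xu xB connect0.
case/setD1P=> fu fC ffx ex; rewrite (component_eq fC) ffx; split=> //.
by rewrite in_setD1 fu (subsetP (component_sub B x)).
Qed.

Lemma paired_add_edge A w v :
  w \in A -> v \in A -> e w v -> paired e (A :\ w :\ v) -> paired e A.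
Proof.
move=> wA vA ewv [f pf].
have wv : w != v by apply: contraTneq ewv => ->; rewrite e_irr.
exists (fun x => if x == w then v else if x == v then w else f x) => x xA.
have [->|xw] := eqVneq x w; first by rewrite eqxx eq_sym (negPf wv).
have [->|xv] := eqVneq x v; first by rewrite eqxx e_sym.
have [] := pf x; first by rewrite !inE xv xw.
by rewrite !inE => /and3P[/negPf fv /negPf fw fA] ffx ex; rewrite fw fv.
Qed.

Lemma NEB_paired A w :
  NEB e A w -> connected_in A -> paired e (if odd #|A| then A :\ w else A).
Proof.
elim=> {A w} [A w wA A1 _|A w wA _ evA oddA _ IH cA].
  rewrite A1 /=; exists id => x /setD1P[xw xA].
  by rewrite (card_le1_eqP (eq_leq A1) x w) ?eqxx in xw.
(* By connectedness every component contains a neighbour of [w], so the induction hypothesis covers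
   all of them. *)
have IHc x : x \in A :\ w -> exists v, [/\ v \in A, e w v,
    component e (A :\ w) v = component e (A :\ w) x &
    paired e (if odd #|component e (A :\ w) x| then component e (A :\ w) x :\ v
              else component e (A :\ w) x)].
  move=> xA; have [v [vA ewv dC]] := component_neighbor cA wA xA.
  by exists v; rewrite -dC; split=> //; apply: IH (@connected_component _ _).
have oddP x : x \in A :\ w -> odd #|component e (A :\ w) x| ->
    component e (A :\ w) x \in odd_components e (A :\ w).
  by move=> xA oC; rewrite inE oC imset_f.
have [oA|eA] := boolP (odd #|A|).
  (* The second deletion is void; it fits the goal to the gluing lemma with [u := w]. *)
  have -> : A :\ w = A :\ w :\ w by apply/setP=> x; rewrite !inE; case: eqP.
  apply: paired_components => x xA.
  have [v [_ _ _]] := IHc x xA.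
  have /negPf-> : ~~ odd #|component e (A :\ w) x|.
    apply/negP => /(oddP x xA).
    by rewrite (cards0_eq (oddA oA)) inE.
  suff -> : component e (A :\ w) x :\ w = component e (A :\ w) x by [].
  by apply/setP=> y; rewrite !inE; case: eqP.
have /eqP/cards1P[C dC] := evA eA.
have: C \in odd_components e (A :\ w) by rewrite dC inE.
rewrite inE => /andP[/imsetP[y yA defC] oC]; rewrite defC in dC oC.
have [v [vA ewv dv]] := IHc y yA; rewrite oC => pC.
apply: (paired_add_edge wA vA ewv); apply: paired_components => x xA.
have vAw : v \in A :\ w.
  by rewrite !inE vA andbT; apply: contraTneq ewv => ->; rewrite e_irr.
have [oCx|eCx] := boolP (odd #|component e (A :\ w) x|).
  by have := oddP x xA oCx; rewrite dC inE => /eqP ->.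
have [v' [_ _ _]] := IHc x xA; rewrite (negPf eCx).
suff -> : component e (A :\ w) x :\ v = component e (A :\ w) x by [].
apply/setP=> z; rewrite in_setD1; case: eqP => // ->; apply/esym/negP => vC.
by rewrite -(component_eq vC) dv oC in eCx.
Qed.

Lemma paired_NEB A w :
    acyclic e -> w \in A -> connected_in A ->
  paired e (if odd #|A| then A :\ w else A) -> NEB e A w.
Proof.
move=> acyc; have [m] := ubnP #|A|; elim: m A w => // m IHm A w leAm wA cA [f pf].
have [A1|A2] := leqP #|A| 1.
  apply: NEB_single => //; apply/eqP; rewrite eqn_leq A1.
  by rewrite card_gt0; apply/set0Pn; exists w.
(* For even [#|A|], [u] is the partner of [w]; for odd [#|A|], it is [w] itself, which lies in no
   component of [A :\ w]. *)
pose u := if odd #|A| then w else f w.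
have pC x : x \in A :\ w -> pairing e (component e (A :\ w) x :\ u) f.
  move=> xA y /setD1P[yu yC].
  have /setD1P[yw yA] := subsetP (component_sub _ _) y yC.
  have [fyA ffy eyf] : [/\ f y \in A :\ w :\ u, f (f y) = y & e y (f y)].
    move: pf yu; rewrite /u; case: ifP => oA pf yu.
      have [] := pf y; first by rewrite !inE yw.
      by rewrite !inE => /andP[-> ->].
    (* Since [f] swaps [w] and [u], it sends a vertex [y] distinct from both to another such
       vertex. *)
    have [fwA ffw _] := pf w wA; have [fyA ffy ->] := pf y yA; split=> //.
    rewrite !inE fyA andbT; apply/andP; split.
      by apply: contra_neq yw => fyw; rewrite -ffy fyw.
    by apply: contra_neq yu => fyw; rewrite -ffy fyw.
  by case/setD1P: fyA => fyu fyA; rewrite in_setD1 fyu (component_adj yC).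
(* A component minus [u] is paired, hence even, so the component is odd exactly when it contains
   [u]. *)
have oddC x : x \in A :\ w ->
    odd #|component e (A :\ w) x| = (u \in component e (A :\ w) x).
  move=> xA; rewrite (cardsD1 u) oddD (odd_paired eG) ?addbF ?oddb //.
  by exists f; apply: pC.
have uNw x : odd #|A| -> (u \in component e (A :\ w) x) = false.
  by move=> oA; rewrite /u oA !inE eqxx.
have uA : ~~ odd #|A| -> u \in A :\ w /\ e w u.
  rewrite /u => /negPf oA; move: pf; rewrite oA => pf; have [fA _ ef] := pf w wA.
  by rewrite ef !inE fA andbT; split=> //; apply: contraTneq ef => ->; rewrite e_irr.
apply: NEB_step => // [eA|oA|v vA ewv].
- have [uAw ewu] := uA eA; apply/eqP/cards1P; exists (component e (A :\ w) u).
  apply/setP=> C; rewrite !inE; apply/andP/eqP => [[/imsetP[x xA ->]]|->].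
    by rewrite oddC // => /component_eq.
  by rewrite imset_f // oddC // mem_component.
- apply: eq_card0 => C; rewrite inE; apply/negP => /andP[/imsetP[x xA ->]].
  by rewrite oddC // uNw.
- have vAw : v \in A :\ w.
    by rewrite !inE vA andbT; apply: contraTneq ewv => ->; rewrite e_irr.
  apply: IHm; [|exact: mem_component|exact: connected_component|].
    rewrite (leq_ltn_trans (subset_leq_card (component_sub _ _))) //.
    by move: leAm; rewrite (cardsD1 w A) wA.
  exists f; rewrite oddC //; have := pC v vAw.
  (* If the component contains [u], acyclicity forces [u = v], so [f] pairs it up to [v], as NEB at
     [v] demands; otherwise it is even and [f] pairs all of it. *)
  have [uC|uC] := boolP (u \in component e (A :\ w) v).
    have eA : ~~ odd #|A| by apply: contraL uC => oA; rewrite uNw.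
    by have [_ ewu] := uA eA; rewrite (acyclic_component acyc ewu ewv vAw uC).
  suff -> : component e (A :\ w) v :\ u = component e (A :\ w) v by [].
  by apply/setP=> z; rewrite in_setD1; case: eqP => // ->; rewrite (negPf uC).
Qed.

End Components.

Theorem theorem2p1 (V : finType) (e : rel V) (n : nat)
    (hT : tree e) (hn : #|V| = n) :
  (exists v : V, NEB e [set: V] v) <-> match_number e = n %/ 2.
Proof.
case: hT => eG V0 cV acyc; rewrite -hn.
have cT : connected_in e [set: V].
  move=> x y _ _; rewrite (@eq_connect _ _ e) // => a b.
  by rewrite /induced /= !inE.
split=> [[v /(NEB_paired eG)/(_ cT)]|].
  by rewrite cardsT => pv; apply/(match_number_half eG) => //; exists v.
case/(match_number_half eG) => // v pv; exists v.
by apply: (paired_NEB eG); rewrite ?inE ?cardsT.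
Qed.
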